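(* Let $G$ be a weighted, undirected, simple graph on $n$ vertices with exactly $q$ connected components $G_1,\dots,G_q$, $q<n$, and let $\widetilde G$ be a graph obtained from $G$ by adding (positively weighted) edges between different components of $G$. Let $L,\widetilde L$ be the weighted Laplacian matrices of $G,\widetilde G$. Let $J=\widetilde J=\{1,2,\dots,q\}$, so that $\mathrm{span}(\mathbf{u}_J)$ is the null-space of $L$ and $\mathrm{span}(\widetilde{\mathbf{u}}_{\widetilde J})$ is the span of the first $q$ eigenvectors of $\widetilde L$. Then $$d_{\mathrm{sp}}\left(\mathrm{span}(\mathbf{u}_J),\mathrm{span}(\widetilde{\mathbf{u}}_{\widetilde J})\right)\le\frac{1}{\widetilde\lambda_{q+1}}\sqrt{\frac1q\sum_{j=1}^q\mathcal{CP}_{\widetilde G}(G_j)} .$$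
   Context: Graph conventions: a graph has vertex set $\{v_1,\dots,v_n\}$ and a symmetric weighted adjacency matrix with zero diagonal whose $(k,l)$ entry is the positive weight of the edge $(v_k,v_l)$ if it exists and $0$ otherwise. The weighted degree matrix is diagonal with entries the row sums of the adjacency matrix, and the Laplacian is degree matrix minus adjacency matrix. $A,\widetilde A$ are the adjacency matrices of $G,\widetilde G$. $\widetilde G$ has the same vertices as $G$, the same edges and weights within each $G_j$, plus added edges joining different $G_j$'s; so each $G_j$ is an induced subgraph of $\widetilde G$. The eigenvalues of $L$ are $0=\lambda_1=\cdots=\lambda_q\le\lambda_{q+1}\le\cdots\le\lambda_n$ with orthonormal eigenvectors $\mathbf{u}_1,\dots,\mathbf{u}_n$, where for $j\le q$, $\mathbf{u}_j$ is equal to $1/\sqrt{|\mathcal V(G_j)|}$ on the vertices of $G_j$ and $0$ elsewhere ($\mathcal V(\cdot)$ is the vertex set). The eigenvalues of $\widetilde L$ are $0=\widetilde\lambda_1\le\cdots\le\widetilde\lambda_n$ with orthonormal eigenvectors $\widetilde{\mathbf{u}}_1,\dots,\widetilde{\mathbf{u}}_n$. $\mathbf{u}_J=\{\mathbf{u}_j\mid j\in J\}$, similarly for $\widetilde{\mathbf{u}}$. Coupling: for an induced subgraph $H\subseteq\widetilde G$, $$\mathcal{CP}_{\widetilde G}(H)=\frac{1}{|\mathcal V(H)|}\left(\sum_{k:\,v_k\in\mathcal V(H)}\Big(\sum_{l:\,v_l\notin\mathcal V(H)}\widetilde A_{kl}\Big)^2+\sum_{l:\,v_l\notin\mathcal V(H)}\Big(\sum_{k:\,v_k\in\mathcal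 V(H)}\widetilde A_{kl}\Big)^2\right).$$ Subspace distance: for $q$-dimensional subspaces $X,Y\subseteq\mathbb{C}^n$ with matrices $\mathbf{X},\mathbf{Y}\in\mathbb{C}^{n\times q}$ whose columns are orthonormal bases of $X,Y$, $d_{\mathrm{sp}}(X,Y)=\frac{1}{\sqrt{2q}}\|\mathbf{X}\mathbf{X}^\dagger-\mathbf{Y}\mathbf{Y}^\dagger\|_F$ (Frobenius norm, $^\dagger$ conjugate transpose; independent of the bases). *)

(* Defs.v *)
From HB Require Import structures.
From mathcomp Require Import all_boot all_order all_algebra.
From mathcomp Require Import reals complex.

Set Implicit Arguments.
Unset Strict Implicit.
Unset Printing Implicit Defensive.

Import Order.TTheory GRing.Theory Num.Theory.
Local Open Scope ring_scope.
Local Open Scope sesquilinear_scope.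
Local Open Scope complex_scope.

(* (k, l) is an edge iff its entry is positive, and the entry is then the
   weight of the edge. *)
Record wgraph (R : realType) (n : nat) := WGraph {
  adj :> 'M[R]_n;
  adj_sym : forall k l, adj k l = adj l k;
  adj_diag : forall k, adj k k = 0;
  adj_ge0 : forall k l, 0 <= adj k l }.

Section Graphs.
Variables (R : realType) (n : nat).
Implicit Type G : wgraph R n.

Definition edge G : rel 'I_n := fun k l => 0 < G k l.

Definition components G : {set {set 'I_n}} :=
  equivalence_partition (connect (edge G)) [set: 'I_n].

Definition degree_mx G : 'M[R]_n := diag_mx (\row_k \sum_l G k l).

Definition laplacian G : 'M[R]_n := degree_mx G - adj G.

(* An induced subgraph is represented by its vertex set. *)
Definition coupling G (H : {set 'I_n}) : R :=
  #|H|%:R^-1 *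
  (\sum_(k in H) (\sum_(l | l \notin H) G k l) ^+ 2 +
   \sum_(l | l \notin H) (\sum_(k in H) G k l) ^+ 2).

Definition normalized_indicator (H : {set 'I_n}) : 'cV[R[i]]_n :=
  \col_k (if k \in H then (Num.sqrt #|H|%:R)^-1%:C else 0).

(* lam lists the eigenvalues of M with multiplicity, in nondecreasing order,
   and u is an orthonormal basis of associated, possibly complex,
   eigenvectors. *)
Definition eigensystem (M : 'M[R]_n) (lam : 'I_n -> R)
    (u : 'I_n -> 'cV[R[i]]_n) : Prop :=
  [/\ forall i j : 'I_n, (i <= j)%N -> lam i <= lam j,
      forall j, map_mx (real_complex R) M *m u j = (lam j)%:C *: u j
    & forall i j, (u i)^t* *m u j = (i == j)%:R%:M].

End Graphs.

Section SubspaceDistance.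
Variables (R : realType) (n : nat).
Local Notation C := R[i].

Definition frobenius (m p : nat) (M : 'M[C]_(m, p)) : R :=
  Num.sqrt (\sum_i \sum_j ComplexField.Normc.normc (M i j) ^+ 2).

Definition orthonormal_basis_mx (q : nat) (X : {vspace 'cV[C]_n})
    (B : 'M[C]_(n, q)) : Prop :=
  B^t* *m B = 1%:M /\ <<[tuple col j B | j < q]>>%VS = X.

(* [dsp] is computed from a chosen orthonormal basis; [dspE] shows that the
   choice is irrelevant.  The rows of [schmidt A] are orthonormal, hence the
   transpositions. *)
Definition onb (X : {vspace 'cV[C]_n}) : 'M[C]_(n, \dim X) :=
  (schmidt (\matrix_(i < \dim X) ((vbasis X)`_i)^T))^T.

Lemma span_colP (q : nat) (B : 'M[C]_(n, q)) (v : 'cV[C]_n) :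
  reflect (exists w : 'cV[C]_q, v = B *m w)
          (v \in <<[tuple col j B | j < q]>>%VS).
Proof.
have colE (w : 'cV[C]_q) :
    B *m w = \sum_(j < q) w j 0 *: [tuple col j B | j < q]`_j.
  apply/colP => k; rewrite !mxE summxE; apply: eq_bigr => j _.
  by rewrite -tnth_nth tnth_mktuple !mxE mulrC.
apply: (iffP idP) => [vX|[w ->]].
  exists (\col_j coord [tuple col j B | j < q] j v).
  by rewrite colE {1}(coord_span vX); apply: eq_bigr => j _; rewrite mxE.
rewrite colE rpred_sum // => j _; rewrite rpredZ //.
by rewrite memv_span // mem_nth // size_tuple.
Qed.

Lemma onbP (X : {vspace 'cV[C]_n}) : orthonormal_basis_mx X (onb X).
Proof.
have le_dn : (\dim X <= n)%N.
  by rewrite (leq_trans (dimvS (subvf X))) // dimvf /dim /= muln1.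
rewrite /orthonormal_basis_mx /onb; set A := (\matrix_(i < _) _).
split.
  have /unitarymxP h := schmidt_unitarymx A le_dn.
  apply: trmx_inj; rewrite trmx_mul trmx1 trmxK -[RHS]h.
  by congr (_ *m _); apply/matrixP => i j; rewrite !mxE.
set B := (schmidt A)^T.
apply/esym/eqP; rewrite eqEdim; apply/andP; split; last first.
  by rewrite (leq_trans (dim_span _)) // size_tuple.
rewrite -{1}(span_basis (vbasisP X)); apply/span_subvP => v.
case/(nthP 0) => i; rewrite size_tuple => lti <-; apply/span_colP.
have /submxP[w ew] : (row (Ordinal lti) A <= schmidt A)%MS.
  exact: submx_trans (row_sub _ _) (schmidt_sub _).
exists w^T; rewrite /B -trmx_mul -ew; apply/colP => k.
by rewrite !mxE.
Qed.

Lemma orthonormal_basis_proj (p q : nat) (X : {vspace 'cV[C]_n})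
    (B : 'M[C]_(n, p)) (D : 'M[C]_(n, q)) :
  orthonormal_basis_mx X B -> orthonormal_basis_mx X D ->
  B *m B^t* = D *m D^t*.
Proof.
have factor (p' q' : nat) (B' : 'M[C]_(n, p')) (D' : 'M[C]_(n, q')) :
    orthonormal_basis_mx X B' -> orthonormal_basis_mx X D' ->
    B' *m B'^t* *m (D' *m D'^t*) = D' *m D'^t*.
  move=> [B1 BX] [_ DX]; rewrite mulmxA; congr (_ *m _).
  apply/matrixP => i j.
  have /span_colP[w ew] : col j D' \in <<[tuple col k B' | k < p']>>%VS.
    rewrite BX -DX; apply/span_colP; exists (delta_mx j 0).
    by rewrite colE.
  have : B' *m B'^t* *m col j D' = col j D'.
    by rewrite ew -mulmxA [_ *m (B' *m w)]mulmxA B1 mul1mx.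
  by move=> /colP/(_ i); rewrite colE mulmxA -!colE !mxE.
move=> hB hD; have e1 := factor _ _ _ _ hB hD.
have e2 := factor _ _ _ _ hD hB.
have herm (r : nat) (M : 'M[C]_(n, r)) : (M *m M^t*)^t* = M *m M^t*.
  by rewrite trmx_mul map_mxM trmxCK.
by rewrite -herm -e2 trmx_mul map_mxM !herm e1.
Qed.

Lemma orthonormal_basis_dim (q : nat) (X : {vspace 'cV[C]_n})
    (B : 'M[C]_(n, q)) : orthonormal_basis_mx X B -> \dim X = q.
Proof.
move=> hB; have := orthonormal_basis_proj hB (onbP X).
move/(congr1 mxtrace); rewrite mxtrace_mulC [RHS]mxtrace_mulC.
rewrite (proj1 hB) (proj1 (onbP X)) !mxtrace1 => /eqP.
by rewrite eqr_nat => /eqP.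
Qed.

Definition dsp (X Y : {vspace 'cV[C]_n}) : R :=
  (Num.sqrt (2 * \dim X)%N%:R)^-1 *
  frobenius (onb X *m (onb X)^t* - onb Y *m (onb Y)^t*).

Lemma dspE (q : nat) (X Y : {vspace 'cV[C]_n}) (B D : 'M[C]_(n, q)) :
  orthonormal_basis_mx X B -> orthonormal_basis_mx Y D ->
  dsp X Y =
  (Num.sqrt (2 * q)%N%:R)^-1 * frobenius (B *m B^t* - D *m D^t*).
Proof.
move=> hB hD; rewrite /dsp (orthonormal_basis_proj (onbP X) hB).
by rewrite (orthonormal_basis_proj (onbP Y) hD) (orthonormal_basis_dim hB).
Qed.

End SubspaceDistance.

(* Main.v *)
Require Import Defs.
From mathcomp Require Import all_boot all_order all_algebra.
From mathcomp Require Import reals complex.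

(* With B and D the matrices of the first q eigenvectors of L and L~,
   |BB* - DD*|^2 = 2(q - |D*B|^2) is twice the sum S of the squared coordinates
   of the u_j, j <= q, along the eigenvectors of L~ of index > q.  As L~ scales
   the coordinate of index i by lambda~_i, lambda~_(q+1)^2 S <= |L~ B|^2.
   Finally L u_j = 0 makes the entries of L~ u_j the sums of the weights of the
   edges leaving G_j, up to sign and to 1/sqrt|G_j|, whence
   |L~ u_j|^2 = CP(G_j).  The division is harmless: lambda~_(q+1) > 0 because
   G~ has at most q components. *)

Set Implicit Arguments.
Unset Strict Implicit.
Unset Printing Implicit Defensive.

Import Order.TTheory GRing.Theory Num.Theory.
Local Open Scope ring_scope.
Local Open Scope sesquilinear_scope.
Local Open Scope complex_scope.

Import ComplexField.Normc.

(** * Squared Frobenius norms *)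

Definition sqnorm (R : realType) (m p : nat) (M : 'M[R[i]]_(m, p)) : R :=
  \sum_i \sum_j normc (M i j) ^+ 2.

Lemma sqr_normcE (R : realType) (z : R[i]) : (normc z ^+ 2)%:C = z^* * z.
Proof. by rewrite rmorphXn /= mulrC -normCK. Qed.

Lemma sqr_normc_real (R : realType) (x : R) : normc x%:C ^+ 2 = x ^+ 2.
Proof. by rewrite /= expr0n /= addr0 sqr_sqrtr ?sqr_ge0. Qed.

Lemma conj_realM (R : realType) (x : R) (z : R[i]) :
  (x%:C * z)^* = x%:C * z^*.
Proof. by rewrite rmorphM; congr (_ * _); apply: conjc_real. Qed.

(** The trace form turns later identities between real norms into matrix algebra over [R[i]], pulled
    back by injectivity of the embedding of [R]. *)
Lemma sqnormE (R : realType) (m p : nat) (M : 'M[R[i]]_(m, p)) :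
  (sqnorm M)%:C = \tr (M^t* *m M).
Proof.
rewrite /sqnorm exchange_big rmorph_sum; apply: eq_bigr => j _.
rewrite mxE rmorph_sum; apply: eq_bigr => i _.
by rewrite [LHS]sqr_normcE !mxE.
Qed.

Lemma sqnorm_isometry (R : realType) (m p r : nat) (W : 'M[R[i]]_(r, m))
    (M : 'M[R[i]]_(m, p)) :
  W^t* *m W = 1%:M -> sqnorm (W *m M) = sqnorm M.
Proof.
move=> W1; apply: (fmorph_inj (real_complex R)).
rewrite /= !sqnormE trmx_mul map_mxM mulmxA -[_ *m W^t* *m W]mulmxA.
by rewrite W1 mulmx1.
Qed.

Lemma sqnorm_orthonormal (R : realType) (m p : nat) (M : 'M[R[i]]_(m, p)) :
  M^t* *m M = 1%:M -> sqnorm M = p%:R.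
Proof.
move=> M1; apply: (fmorph_inj (real_complex R)).
by rewrite /= sqnormE M1 mxtrace1 rmorph_nat.
Qed.

(** Expand the trace of the squared Hermitian difference: each projection contributes q, and by
    cyclicity of the trace each cross term is the squared norm of [D^t* *m B]. *)
Lemma sqnorm_projB (R : realType) (n q : nat) (B D : 'M[R[i]]_(n, q)) :
  B^t* *m B = 1%:M -> D^t* *m D = 1%:M ->
  sqnorm (B *m B^t* - D *m D^t*) = 2 * (q%:R - sqnorm (D^t* *m B)).
Proof.
move=> B1 D1; apply: (fmorph_inj (real_complex R)).
have herm (M : 'M[R[i]]_(n, q)) : (M *m M^t*)^t* = M *m M^t*.
  by rewrite trmx_mul map_mxM trmxCK.
have trp (M N : 'M[R[i]]_(n, q)) :
    \tr (M *m M^t* *m (N *m N^t*)) = \tr ((N^t* *m M)^t* *m (N^t* *m M)).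
  by rewrite trmx_mul map_mxM trmxCK -mulmxA mxtrace_mulC !mulmxA.
have hermB : (B *m B^t* - D *m D^t*)^t* = B *m B^t* - D *m D^t*.
  by rewrite [(_ - _)^T]linearB map_mxB !herm.
rewrite rmorphM rmorphB /= !sqnormE hermB.
have tr_sqrB (P Q : 'M[R[i]]_n) :
    \tr ((P - Q) *m (P - Q)) =
    \tr (P *m P) + \tr (Q *m Q) - \tr (P *m Q) *+ 2.
  have trB (M N : 'M[R[i]]_n) : \tr (M - N) = \tr M - \tr N.
    exact: raddfB.
  rewrite mulmxBl !mulmxBr !trB [\tr (Q *m P)]mxtrace_mulC opprB addrACA -opprD.
  by rewrite mulr2n.
rewrite tr_sqrB !trp B1 D1 trmx1 map_mx1 mulmx1 mxtrace1 !rmorph_nat.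
by rewrite mulrBr mulr_natl mulr2n [2 * _]mulr_natl.
Qed.

(** * The Laplacian: action, quadratic form and coupling *)

Lemma laplacian_mulE (R : realType) (n : nat) (G : wgraph R n)
    (x : 'cV[R[i]]_n) k :
  (map_mx (real_complex R) (laplacian G) *m x) k 0 =
  \sum_l (G k l)%:C * (x k 0 - x l 0).
Proof.
rewrite /laplacian map_mxB mulmxBl !mxE.
under eq_bigr => l _ do rewrite !mxE.
rewrite (bigD1 k) //= eqxx mulr1n [X in _ + X - _]big1 ?addr0; last first.
  by move=> l nlk; rewrite eq_sym (negPf nlk) mulr0n mul0r.
rewrite rmorph_sum mulr_suml -sumrB; apply: eq_bigr => l _.
by rewrite mxE mulrBr.
Qed.

Lemma laplacian_herm (R : realType) (n : nat) (G : wgraph R n) :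
  (map_mx (real_complex R) (laplacian G))^t* =
  map_mx (real_complex R) (laplacian G).
Proof.
apply/matrixP => k l; rewrite !mxE adj_sym.
rewrite [LHS]conjc_real.
by case: eqVneq => [->|].
Qed.

Lemma laplacian_form (R : realType) (n : nat) (G : wgraph R n)
    (x : 'cV[R[i]]_n) :
  (x^t* *m (map_mx (real_complex R) (laplacian G) *m x)) 0 0 *+ 2 =
  (\sum_k \sum_l G k l * normc (x k 0 - x l 0) ^+ 2)%:C.
Proof.
rewrite !mxE; under eq_bigr => k _ do rewrite laplacian_mulE !mxE mulr_sumr.
(* In one of the two copies [k] and [l] are exchanged; by symmetry of [G] the terms then pair up
   into squared moduli. *)
rewrite mulr2n {2}exchange_big -big_split rmorph_sum; apply: eq_bigr => k _ /=.
rewrite -big_split rmorph_sum; apply: eq_bigr => l _ /=.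
rewrite rmorphM /= sqr_normcE rmorphB (adj_sym G l k) /=.
rewrite mulrCA [in X in _ + X]mulrCA -mulrDr mulrBl.
by rewrite -[x l 0 - x k 0]opprB mulrN.
Qed.

(** Each entry of the product sums weighted differences of indicator values, so only edges crossing
    the boundary of [H] count. The two sums of [coupling] come from the entries inside and outside
    [H]. *)
Lemma sqnorm_laplacian_indicator (R : realType) (n : nat) (G : wgraph R n)
    (H : {set 'I_n}) :
  sqnorm (map_mx (real_complex R) (laplacian G) *m normalized_indicator R H) =
  coupling G H.
Proof.
have sqc (t : R) : ((Num.sqrt #|H|%:R)^-1 * t) ^+ 2 = #|H|%:R^-1 * t ^+ 2.
  by rewrite exprMn exprVn sqr_sqrtr.
rewrite /sqnorm /coupling (bigID (mem H)) /= mulrDr !mulr_sumr.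
congr (_ + _); apply: eq_bigr => k kH; rewrite big_ord1 laplacian_mulE -sqc.
  rewrite -[RHS]sqr_normc_real; congr (normc _ ^+ 2).
  rewrite (bigID (mem H)) /= big1 ?add0r => [|l lH]; last first.
    by rewrite !mxE kH lH subrr mulr0.
  rewrite rmorphM rmorph_sum mulr_sumr; apply: eq_bigr => l lH.
  by rewrite !mxE kH (negPf lH) subr0 mulrC.
(* Outside [H] the differences have the opposite sign, which the square absorbs. *)
rewrite -[RHS]sqrrN -[RHS]sqr_normc_real; congr (normc _ ^+ 2).
rewrite (bigID (mem H)) /= [X in _ + X]big1 ?addr0 => [|l lH]; last first.
  by rewrite !mxE (negPf kH) (negPf lH) subrr mulr0.
rewrite rmorphN rmorphM rmorph_sum mulr_sumr -sumrN; apply: eq_bigr => l lH.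
by rewrite !mxE (negPf kH) lH sub0r mulrN mulrC adj_sym.
Qed.

(** * Coordinates in an orthonormal eigenbasis *)

Section Eigensystem.

Variables (R : realType) (n : nat) (M : 'M[R]_n).
Variables (lam : 'I_n -> R) (u : 'I_n -> 'cV[R[i]]_n).
Hypothesis M_eig : eigensystem M lam u.

Let U : 'M[R[i]]_n := \matrix_(k, i) u i k 0.

Lemma eigenbasis_orthonormal (q : nat) (f : 'I_q -> 'I_n) :
  injective f -> (colsub f U)^t* *m colsub f U = 1%:M.
Proof.
case: M_eig => _ _ orth f_inj; apply/matrixP => i j.
have := congr1 (fun A : 'M_1 => A 0 0) (orth (f i) (f j)).
rewrite !mxE eqxx mulr1n (inj_eq f_inj) => <-.
by apply: eq_bigr => k _; rewrite !mxE.
Qed.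

(** Parseval: [U] is square, so its orthonormal columns force orthonormal rows. *)
Lemma eigenbasis_adj_isometry (q : nat) (B : 'M[R[i]]_(n, q)) :
  sqnorm (U^t* *m B) = sqnorm B.
Proof.
apply: sqnorm_isometry; rewrite trmxCK; apply: mulmx1C.
have := eigenbasis_orthonormal (f := id) (fun _ _ e => e).
by rewrite mxsub_id.
Qed.

(** Conjugate the eigenvector equations, using that [M] is real symmetric and [lam] is real. *)
Lemma eigen_coord_mul (q : nat) (B : 'M[R[i]]_(n, q)) i j :
  M^T = M ->
  (U^t* *m (map_mx (real_complex R) M *m B)) i j =
  (lam i)%:C * (U^t* *m B) i j.
Proof.
case: M_eig => _ eigM _ symM.
have lU : U^t* *m map_mx (real_complex R) M =
            diag_mx (\row_i (lam i)%:C) *m U^t*.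
  rewrite mul_diag_mx; apply/matrixP => k l; rewrite !mxE.
  have := congr1 (fun v : 'cV_n => (v l 0)^*) (eigM k).
  rewrite !mxE conj_realM => <-.
  rewrite rmorph_sum; apply: eq_bigr => m _.
  by rewrite !mxE [RHS]conj_realM -{1}symM mxE mulrC.
by rewrite mulmxA lU -mulmxA mul_diag_mx !mxE.
Qed.

(** Drop the coordinates of index below [p]; on the others [lam p <= lam i], and [0 <= lam p] allows
    squaring this. *)
Lemma eigen_tail_le (q : nat) (B : 'M[R[i]]_(n, q)) (p : 'I_n) :
  M^T = M -> 0 <= lam p ->
  lam p ^+ 2 *
    (\sum_(i < n | (p <= i)%N) \sum_j normc ((U^t* *m B) i j) ^+ 2)
  <= sqnorm (map_mx (real_complex R) M *m B).
Proof.
case: (M_eig) => mono _ _ symM lamp.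
rewrite -[leRHS]eigenbasis_adj_isometry /sqnorm mulr_sumr.
rewrite [leRHS](bigID (fun i : 'I_n => (p <= i)%N)) /=.
apply: ler_wpDr.
  by rewrite sumr_ge0 // => i _; rewrite sumr_ge0 // => j _; rewrite sqr_ge0.
apply: ler_sum => i lepi; rewrite mulr_sumr; apply: ler_sum => j _.
rewrite eigen_coord_mul // normcM exprMn sqr_normc_real.
rewrite ler_wpM2r ?sqr_ge0 // lerXn2r ?mono // nnegrE //.
by rewrite (le_trans lamp) ?mono.
Qed.

Lemma eigen_coord_head (q : nat) (leqn : (q <= n)%N) (B : 'M[R[i]]_(n, q)) :
  sqnorm ((colsub (widen_ord leqn) U)^t* *m B) =
  sqnorm B - \sum_(i < n | (q <= i)%N) \sum_j normc ((U^t* *m B) i j) ^+ 2.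
Proof.
rewrite -[in RHS]eigenbasis_adj_isometry /sqnorm.
rewrite [in RHS](bigID (fun i : 'I_n => (q <= i)%N)) /= addrAC subrr add0r.
under [in RHS]eq_bigl => i do rewrite -ltnNge.
rewrite big_ord_narrow /=; apply: eq_bigr => i _; apply: eq_bigr => j _.
by congr (normc _ ^+ 2); rewrite !mxE; apply: eq_bigr => k _; rewrite !mxE.
Qed.

End Eigensystem.

(** * Connectivity and positivity of the eigenvalue of index q+1 *)

Lemma laplacian_sym (R : realType) (n : nat) (G : wgraph R n) :
  (laplacian G)^T = laplacian G.
Proof.
apply/matrixP => k l; rewrite !mxE adj_sym.
by case: eqVneq => [->|].
Qed.

Lemma connect_edge_sym (R : realType) (n : nat) (G : wgraph R n) :
  connect_sym (edge G).
Proof. by apply: sym_connect_sym => k l; rewrite /edge adj_sym. Qed.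

(** Twice the form is a sum of nonnegative terms, so each term vanishes; a positive weight forces
    equal values across an edge, hence along a path. *)
Lemma laplacian_form_le0 (R : realType) (n : nat) (G : wgraph R n)
    (x : 'cV[R[i]]_n) :
  (x^t* *m (map_mx (real_complex R) (laplacian G) *m x)) 0 0 <= 0 ->
  forall k l, connect (edge G) k l -> x k 0 = x l 0.
Proof.
move=> form_le0; have : \sum_k \sum_l G k l * normc (x k 0 - x l 0) ^+ 2 <= 0.
  by rewrite -lecR -laplacian_form pmulrn_lle0.
have term_ge0 k l : 0 <= G k l * normc (x k 0 - x l 0) ^+ 2.
  by rewrite mulr_ge0 ?adj_ge0 ?sqr_ge0.
rewrite le_eqVlt ltNge sumr_ge0 ?orbF => [|k _]; last exact: sumr_ge0.
rewrite psumr_eq0 => [/allP sum0|k _]; last exact: sumr_ge0.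
suff step k l : edge G k l -> x k 0 = x l 0.
  move=> k l /connectP[p + ->]; elim: p k => //= m p IHp k.
  by case/andP=> /step-> /IHp.
move=> Gkl; move: (sum0 k (mem_index_enum k)) => /=.
rewrite psumr_eq0 // => /allP/(_ l (mem_index_enum l)) /=.
rewrite mulf_eq0 gt_eqF //= sqrf_eq0 => /eqP/eq0_normc/eqP.
by rewrite subr_eq0 => /eqP.
Qed.

(* Otherwise the first q + 1 orthonormal eigenvectors would be constant on the
   q blocks of f, hence would span a space of dimension at most q. *)
Lemma laplacian_eigen_gt0 (R : realType) (n q : nat) (ltqn : (q < n)%N)
    (G : wgraph R n) (lam : 'I_n -> R) (u : 'I_n -> 'cV[R[i]]_n)
    (f : 'I_n -> 'I_q) :
  eigensystem (laplacian G) lam u ->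
  (forall k l, f k = f l -> connect (edge G) k l) ->
  0 < lam (Ordinal ltqn).
Proof.
move=> L_eig f_conn; rewrite ltNge; apply/negP => lamq_le0.
have [mono eigL orth] := L_eig.
(* [ltqn] unfolds to [q.+1 <= n], so [W] has q+1 columns; with indices from 0, [Ordinal ltqn] is the
   last one. *)
pose W := colsub (widen_ord ltqn) (\matrix_(k, i) u i k 0).
(* [r j] represents block [j]; the default occurs only for an empty block, whose row of [T] is never
   selected by [rowsub f]. *)
pose r j := odflt (Ordinal ltqn) [pick k | f k == j].
pose T := \matrix_(j, i) W (r j) i.
have WE : W = rowsub f T.
  apply/matrixP => k i; rewrite !mxE.
  apply: (laplacian_form_le0 (G := G)); last first.
    apply: f_conn; rewrite /r; case: pickP => [l /eqP|/(_ k)] //=.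
    by rewrite eqxx.
  rewrite eigL -scalemxAr orth eqxx !mxE mulr1n mulr1 lecR.
  by rewrite (le_trans _ lamq_le0) // mono //= -ltnS.
have W1 : W^t* *m W = 1%:M.
  by apply: (eigenbasis_orthonormal L_eig) => i j [/val_inj].
(* The rank q+1 of the identity is at most that of [W], hence at most the number q of rows of
   [T]. *)
have := mxrankM_maxr (W^t*) W; rewrite W1 mxrank1 WE.
rewrite -[T]mul1mx -mul_rowsub_mx => /leq_trans/(_ (mxrankM_maxr _ _)).
by move=> /leq_trans/(_ (rank_leq_row _)); rewrite ltnn.
Qed.

Lemma components_connect (R : realType) (n : nat) (G : wgraph R n)
    (H : {set 'I_n}) k l :
  H \in components G -> k \in H -> l \in H -> connect (edge G) k l.
Proof.
case/imsetP => x _ ->; rewrite !inE /= => xk xl.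
by apply: connect_trans xl; rewrite connect_edge_sym.
Qed.

Lemma mem_component (R : realType) (n : nat) (G : wgraph R n) k :
  [set l | connect (edge G) k l] \in components G.
Proof. by apply/imsetP; exists k => //; apply/setP => l; rewrite !inE. Qed.

Theorem proposition3 (R : realType) (n q : nat) (ltqn : (q < n)%N)
    (G Gt : wgraph R n) (V : 'I_q -> {set 'I_n})
    (V_inj : injective V) (V_comp : [set V j | j : 'I_q] = components G)
    (Gt_within : forall j k l, k \in V j -> l \in V j -> Gt k l = G k l)
    (lam lamt : 'I_n -> R) (u ut : 'I_n -> 'cV[R[i]]_n)
    (L_eig : eigensystem (laplacian G) lam u)
    (Lt_eig : eigensystem (laplacian Gt) lamt ut)
    (u_ind : forall j : 'I_q,
       u (widen_ord (ltnW ltqn) j) = normalized_indicator R (V j)) :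
  dsp <<[tuple u (widen_ord (ltnW ltqn) j) | j < q]>>%VS
      <<[tuple ut (widen_ord (ltnW ltqn) j) | j < q]>>%VS
  <= (lamt (Ordinal ltqn))^-1 *
     Num.sqrt (q%:R^-1 * \sum_(j < q) coupling Gt (V j)).
Proof.
have widen_inj : injective (widen_ord (ltnW ltqn)).
  by move=> i j [/val_inj].
pose head (w : 'I_n -> 'cV[R[i]]_n) : 'M_(n, q) :=
  colsub (widen_ord (ltnW ltqn)) (\matrix_(k, i) w i k 0).
have head_onb lam' M w : eigensystem (R := R) M lam' w ->
    orthonormal_basis_mx <<[tuple w (widen_ord (ltnW ltqn) j) | j < q]>>%VS
      (head w).
  move=> w_eig; split; first exact: (eigenbasis_orthonormal w_eig).
  congr <<tval _>>%VS; apply: eq_from_tnth => j; rewrite !tnth_mktuple.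
  by apply/colP => k; rewrite !mxE.
have V_mem k : exists j, V j = [set l | connect (edge G) k l].
  by have := mem_component G k; rewrite -V_comp => /imsetP[j _ ->]; exists j.
have [f fP] : exists f : 'I_n -> 'I_q, forall k, k \in V (f k).
  apply: (@fin_all_exists _ _ (fun k j => k \in V j)) => k.
  by have [j Vj] := V_mem k; exists j; rewrite Vj inE.
(* A neighbour of [k] in [G] lies in the component of [k], where both graphs have the same
   weights. *)
have edgeS : subrel (edge G) (edge Gt).
  move=> k l Gkl; have [j Vj] := V_mem k.
  by rewrite /edge (Gt_within j) // Vj inE // connect1.
(* Each [V j] stays connected in [Gt], so sorting the vertices by component of [G] gives the
   required q blocks. *)
have lamt_gt0 : 0 < lamt (Ordinal ltqn).
  apply: (laplacian_eigen_gt0 ltqn (f := f) Lt_eig) => k l efkl.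
  apply: (connect_sub (e := edge G)) => [x y /edgeS/connect1//|].
  apply: (components_connect (H := V (f k))); last by rewrite efkl.
    by rewrite -V_comp imset_f.
  exact: fP.
have [B1 _] := head_onb _ _ _ L_eig; have [D1 _] := head_onb _ _ _ Lt_eig.
rewrite (dspE (head_onb _ _ _ L_eig) (head_onb _ _ _ Lt_eig)).
rewrite /frobenius -/(sqnorm _) sqnorm_projB //.
(* The squared norm of the first basis is q, so q minus the head leaves exactly the tail sum. *)
rewrite (eigen_coord_head Lt_eig) (sqnorm_orthonormal B1) subKr.
set S := \sum_(i | _) _.
have lam_S : lamt (Ordinal ltqn) ^+ 2 * S <= \sum_(j < q) coupling Gt (V j).
  have <- : sqnorm (map_mx (real_complex R) (laplacian Gt) *m head u) =
            \sum_(j < q) coupling Gt (V j).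
    under [RHS]eq_bigr => j _ do rewrite -sqnorm_laplacian_indicator -u_ind.
    rewrite /sqnorm exchange_big; apply: eq_bigr => j _.
    apply: eq_bigr => k _; rewrite big_ord1 !mxE; congr (normc _ ^+ 2).
    by apply: eq_bigr => l _; rewrite !mxE.
  exact: (eigen_tail_le Lt_eig _ (laplacian_sym Gt) (ltW lamt_gt0)).
have S_ge0 : 0 <= S.
  by rewrite sumr_ge0 // => i _; rewrite sumr_ge0 // => j _; rewrite sqr_ge0.
(* Clear the denominator and gather each side under one root: the factors 2 cancel, the eigenvalue
   enters as the root of its square, and [lam_S] divided by q remains. *)
rewrite -(@ler_pM2l _ (lamt (Ordinal ltqn))) // mulVKf ?gt_eqF //.
rewrite natrM -sqrtrV ?mulr_ge0 // -sqrtrM ?invr_ge0 ?mulr_ge0 //.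
rewrite -[lamt _]ger0_norm ?(ltW lamt_gt0) // -sqrtr_sqr -sqrtrM ?sqr_ge0 //.
rewrite ler_wsqrtr // invfM [2^-1 * _ * _]mulrACA mulVf ?pnatr_eq0 // mul1r mulrCA.
by rewrite ler_wpM2l ?invr_ge0.
Qed.
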